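(* Let $(X,d)$ be a compact metric space, $f\colon X\to X$ a continuous map, and $\ell\ge 1$ an integer. If $f$, or some positive iterate $f^n$ ($n\geq 1$) of $f$, has a one-way $\ell$-horseshoe, then $h_{\mathrm{pol}}(f)\geq \ell$.
   Context: Polynomial entropy: a set $S\subseteq X$ is $(n,\varepsilon,f)$-separated if $\max_{0\le i\le n-1} d(f^i(x),f^i(y))>\varepsilon$ for any two distinct $x,y\in S$. Let $\mathrm{sep}(n,\varepsilon,f)$ be the maximal cardinality of an $(n,\varepsilon,f)$-separated subset of $X$. Then $h_{\mathrm{pol}}(f)=\lim_{\varepsilon\to0}\limsup_{n\to\infty}\frac{\log \mathrm{sep}(n,\varepsilon,f)}{\log n}\in[0,\infty]$. One-way horseshoe: for a continuous map $g\colon X\to X$, a one-way $\ell$-horseshoe (one-way horseshoe of order $\ell$) for $g$ is an indexed family $A_1,\dots,A_\ell$ of pairwise disjoint compact subsets of $X$ such that $A_\ell$ contains a non-recurrent point of $g$ and $g(A_i)\supseteq A_j$ for all $1\le i\le j\le \ell$. A point $x$ is recurrent for $g$ if for every $\varepsilon>0$ there is $n\ge1$ with $d(g^n(x),x)<\varepsilon$; otherwise it is non-recurrent. (Each iterate $g^n$, $n\ge 1$, has the same recurrent points as $g$.) *)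

(* Defs.v *)
(* MathComp-Analysis *)
From HB Require Import structures.
From mathcomp Require Export all_boot all_order all_algebra.
From mathcomp Require Export all_classical all_reals all_analysis.

Set Implicit Arguments.
Unset Strict Implicit.
Unset Printing Implicit Defensive.

Import Order.TTheory GRing.Theory Num.Theory.
Import numFieldNormedType.Exports.

Local Open Scope classical_set_scope.
Local Open Scope ring_scope.

Section polynomial_entropy.
Context {R : realType} {X : metricType R}.
Implicit Types (f : X -> X) (S : set X) (n : nat) (e : R).

Definition separated n e f S : Prop :=
  forall x y, S x -> S y -> x <> y ->
    e < \big[Num.max/0]_(0 <= i < n) mdist (iter i f x) (iter i f y).

(* Subsets of separated sets are separated, so the supremum over finite
   separated sets is the maximal cardinality whenever the latter is finite
   (in particular for X compact and f continuous), and +oo otherwise. *)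
Definition sep n e f : \bar R :=
  ereal_sup [set k%:R%:E | k in
    [set k : nat | exists2 S, separated n e f S & (S #= `I_k)%card]].

(* The inner limsup is nonincreasing in e, so the limit at 0+ exists.
   The meaningless terms n = 0, 1 do not affect the limsup. *)
Definition hpol f : \bar R :=
  lim ((limn_esup (fun n => lne (sep n e f) / (ln n%:R)%:E)%E)
         @[e --> (0 : R)^'+]).

End polynomial_entropy.

Section one_way_horseshoe.
Context {R : realType} {X : metricType R}.
Implicit Types g : X -> X.

Definition recurrent g (x : X) : Prop :=
  forall e : R, 0 < e -> exists2 n : nat, (1 <= n)%N & mdist (iter n g x) x < e.

(* The family is A 1, ..., A l; values of A at other indices are unused
   (for l >= 1). *)
Definition one_way_horseshoe g (l : nat) (A : nat -> set X) : Prop :=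
  [/\ forall i, (1 <= i <= l)%N -> compact (A i),
      trivIset [set i | (1 <= i <= l)%N] A,
      exists2 x, A l x & ~ recurrent g x &
      forall i j, (1 <= i)%N -> (i <= j)%N -> (j <= l)%N -> A j `<=` g @` A i].

Definition has_one_way_horseshoe g (l : nat) : Prop :=
  exists A : nat -> set X, one_way_horseshoe g l A.

End one_way_horseshoe.

(* Main.v *)
(* Let g = f^k carry the horseshoe and let x in A_l be non-recurrent. Every
   nondecreasing word w over {1..l} is followed by some point y_w, which visits
   A_{w_0}, A_{w_1}, ... and then hits x after |w| steps of g. Words of
   different lengths give separated points because the forward orbit of x stays
   away from x; distinct words of equal length do because the A_i are at
   positive distance from each other. The words of length < l m contain
   m^l ones of the form 1^{a_1} ... l^{a_l}, a_i < m, so that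
   sep (k l m) e f >= m^l for all small e, whence hpol f >= l. *)
Require Import Defs.
From mathcomp Require Import zify lra.
Import Order.TTheory GRing.Theory Num.Theory.
Import numFieldNormedType.Exports.
Local Open Scope classical_set_scope.
Local Open Scope ring_scope.

(** As [e] is nonnegative, strict separation forces [z] to be injective, so its image has exactly
    [#|T|] points. *)
Lemma le_sep_card (R : realType) (X : metricType R) (n : nat) (e : R)
    (f : X -> X) (T : finType) (z : T -> X) : 0 <= e ->
  (forall a b, a != b -> exists2 i, (i < n)%N &
     e < mdist (iter i f (z a)) (iter i f (z b))) ->
  ((#|T|)%:R%:E <= sep n e f)%E.
Proof.
move=> e0 sepz; apply: ereal_sup_ubound; exists #|T| => //=.
case: (pickP T) => [a0 _|T0]; last first.
  exists set0; first by move=> ? ? [].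
  by rewrite (eq_card0 T0) II0.
pose h i := nth a0 (enum T) i.
have h_inj i j : (i < #|T|)%N -> (j < #|T|)%N -> h i = h j -> i = j.
  move=> iT jT /eqP; rewrite nth_uniq -?cardE ?enum_uniq//; exact: eqP.
have zh_inj i j : (i < #|T|)%N -> (j < #|T|)%N -> z (h i) = z (h j) -> i = j.
  move=> iT jT zij; apply: h_inj => //; apply/eqP/negPn/negP => /sepz[s _].
  by rewrite zij mdistxx ltNge e0.
exists ((z \o h) @` `I_#|T|).
  move=> _ _ [i iT <-] [j jT <-] ij; have /sepz[s sn lts] : h i != h j.
    by apply/eqP => hij; apply: ij; rewrite /= hij.
  apply: (lt_le_trans lts).
  by apply: (@bigmax_sup_seq _ _ _ _ _ s); rewrite ?mem_index_iota.
by apply: inj_card_eq => i j /set_mem iT /set_mem jT; exact: zh_inj.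
Qed.

Lemma sep_ge0 (R : realType) (X : metricType R) n (e : R) (f : X -> X) :
  (0 <= sep n e f)%E.
Proof.
apply: ereal_sup_ubound; exists 0%N => //=; exists set0; first by move=> ? ? [].
by rewrite II0.
Qed.

Lemma sep_nincr (R : realType) (X : metricType R) n (e e' : R) (f : X -> X) :
  e <= e' -> (sep n e' f <= sep n e f)%E.
Proof.
move=> ee'; apply: ereal_sup_le => _ [k [S sepS cardS] <-].
exists k => //; exists S => // x y Sx Sy xy.
exact: le_lt_trans (sepS _ _ Sx Sy xy).
Qed.

Lemma ln_nat_ge0 (R : realType) n : 0 <= ln n%:R :> R.
Proof. by case: n => [|n]; [rewrite ln0|rewrite ln_ge0// ler1n]. Qed.

Lemma limn_esup_ge (R : realType) (u : nat -> \bar R) (l : \bar R) :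
  (forall N (e : R), 0 < e -> exists2 n, (N <= n)%N & (l <= u n + e%:E)%E) ->
  (l <= limn_esup u)%E.
Proof.
move=> H; apply: le_ereal_inf_tmp => _ [V [N _ NV] <-].
apply/lee_addgt0Pr => e e0; have [n Nn /le_trans] := H N e e0; apply.
by apply: leeD => //; apply: ereal_sup_ubound; exists n => //; exact: NV.
Qed.

Lemma hpol_cvg (R : realType) (X : metricType R) (f : X -> X) :
  cvg ((limn_esup (fun n => lne (sep n e f) / (ln n%:R)%:E)%E)
         @[e --> (0 : R)^'+]).
Proof.
apply: nonincreasing_at_right_is_cvge; near=> x => e e' _ _ ee'.
(* The upper limit is an infimum, over eventual sets [V], of suprema over [V]; the two are compared
   for each [V] separately. *)
apply: le_ereal_inf_tmp => _ [V VN <-].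
apply: le_trans (ereal_inf_lbound _) _; first by exists V.
apply: ge_ereal_sup => _ [n Vn <-].
apply: (@le_trans _ _ (lne (sep n e f) / (ln n%:R)%:E)%E).
  apply: lee_wpmul2r; first by rewrite inve_ge0 lee_fin ln_nat_ge0.
  rewrite lee_lne ?in_itv/= ?leey ?sep_ge0//.
  exact: sep_nincr.
by apply: ereal_sup_ubound; exists n.
Unshelve. all: by end_near. Qed.

(** A limsup is bounded below along the subsequence [C * m], and the factor [C] is harmless because
    ln (C m) / ln m tends to 1. *)
Lemma hpol_ge_growth (R : realType) (X : metricType R) (f : X -> X) (l C : nat) :
  (0 < C)%N ->
  (\forall e \near (0 : R)^'+, forall m, (0 < m)%N ->
     ((m ^ l)%:R%:E <= sep (C * m) e f)%E) ->
  (l%:R%:E <= hpol f)%E.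
Proof.
move=> C0 Hsep; apply: lime_ge; first exact: hpol_cvg.
apply: filterS Hsep => e He; apply: limn_esup_ge => N d d0.
(* This threshold gives d ln m >= l ln C, which implies l ln m / ln (C m) >= l - d. The 2 in [m]
   keeps ln m positive. *)
pose B : R := expR (l%:R * ln C%:R / d).
pose m := (maxn N 2 + Num.bound B)%N.
have m1 : (1 < m)%N by rewrite /m; lia.
have m0 : (0 < m)%N by lia.
have mR0 : 0 < m%:R :> R by rewrite ltr0n.
have CR0 : 0 < C%:R :> R by rewrite ltr0n.
have Cm : (m <= C * m)%N by rewrite leq_pmull.
exists (C * m)%N; first by apply: leq_trans Cm; rewrite /m; lia.
have lnm : l%:R * ln C%:R / d <= ln m%:R.
  rewrite -[leLHS]expRK ler_ln ?posrE ?expR_gt0// -/B.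
  by rewrite (le_trans (ltW (archi_boundP (expR_ge0 _))))// ler_nat leq_addl.
have lnm0 : 0 < ln m%:R :> R by rewrite ln_gt0// ltr1n.
have lnC0 := ln_nat_ge0 R C.
have lnCm : ln (C * m)%:R = ln C%:R + ln m%:R :> R.
  by rewrite natrM lnM ?posrE.
apply: (@le_trans _ _ (l%:R * ln m%:R / ln (C * m)%:R + d)%:E).
  rewrite lee_fin lnCm -lerBlDr ler_pdivlMr; last lra.
  have : l%:R * ln C%:R <= ln m%:R * d by rewrite -ler_pdivrMr.
  nra.
rewrite EFinD EFinM leeD2r//.
have -> : ((ln (C * m)%:R)^-1%:E = ((ln (C * m)%:R)%:E)^-1 :> \bar R)%E.
  by rewrite inver lnCm gt_eqF//; lra.
apply: lee_wpmul2r; first by rewrite inve_ge0 lee_fin ln_nat_ge0.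
have -> : l%:R * ln m%:R = ln ((m ^ l)%:R) :> R.
  by rewrite natrX lnXn// mulr_natl.
rewrite -lne_EFin; last by rewrite ltr0n expn_gt0 m0.
rewrite lee_lne ?in_itv/= ?leey ?sep_ge0 ?lee_fin ?ler0n//.
exact: He.
Qed.

(** Each point of [A] has a ball of some radius r missing [B]. On the concentric ball of radius r/2
    the gap to [B] is at least r/2, and compactness of [A] makes the gap uniform. *)
Lemma near_mdist_gt (R : realType) (X : metricType R) (A B : set X) :
  compact A -> closed B -> A `&` B = set0 ->
  \forall e \near (0 : R)^'+, forall x y, A x -> B y -> e < mdist x y.
Proof.
move=> cA cB AB0.
have /compact_near_coveringP/(_ _ (0 : R)^'+
  (fun e x => forall y, B y -> e < mdist x y) _) := cA.
move=> H; suff : \forall e \near (0 : R)^'+,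
    A `<=` (fun x => forall y, B y -> e < mdist x y).
  by apply: filterS => e He x y /He; exact.
apply: H => x Ax.
have /open_nbhs_nbhs : open_nbhs x (~` B).
  split; first exact: closed_openC.
  by move=> Bx; have : (A `&` B) x by []; rewrite AB0.
move=> /nbhs_ballP[r /= r0 rB].
exists (ball x (r / 2), [set e | e < r / 2]) => /=.
  split; first by apply: nbhsx_ballx; lra.
  by apply: nbhs_right_lt; lra.
move=> [x' e]/= [xx' er] y By; rewrite ltNge; apply/negP => x'y.
apply: (rB y) => //; move: xx'; rewrite !ballEmdist/= => xx'.
by apply: le_lt_trans (metric_triangle _ x' _) _; lra.
Qed.

Lemma near_nonrecurrent (R : realType) (X : metricType R) (g : X -> X) x :
  ~ recurrent g x ->
  \forall e \near (0 : R)^'+, forall n, (0 < n)%N -> e < mdist (iter n g x) x.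
Proof.
move=> /existsNP[r /not_implyP[r0 /forallPNP nx]].
near=> e => n /nx /negP; rewrite -leNgt; apply: lt_le_trans.
by near: e; exact: nbhs_right_lt.
Unshelve. all: by end_near. Qed.

(** The point [x] is pulled back along the word from its last letter to its first, by the covering
    relations. The default [l] of [nth] covers the final time [size w], when the orbit is at [x] in
    [A l]. *)
Lemma itinerary_point (R : realType) (X : metricType R) (g : X -> X) l A x w :
  one_way_horseshoe g l A -> A l x ->
  sorted leq w -> all (fun i => 1 <= i <= l)%N w ->
  exists2 y, iter (size w) g y = x &
    forall s, (s <= size w)%N -> A (nth l w s) (iter s g y).
Proof.
move=> [_ _ _ gA] Alx; elim: w => [|i w IH] /=.
  by move=> _ _; exists x => // -[].
move=> iw /andP[/andP[i1 il] wl].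
have [y' yx Ay'] := IH (path_sorted iw) wl.
have iw0 : (i <= nth l w 0 <= l)%N.
  case: (w) iw wl => [|j w'] /=; first by rewrite il leqnn.
  by move=> /andP[-> _] /andP[/andP[_ ->]].
have [iw0l iw0r] := andP iw0.
have [y Ay gy] : (g @` A i) y'.
  by apply: (gA i _ i1 iw0l iw0r); exact: (Ay' 0%N).
exists y; first by rewrite -iterS iterSr gy.
by move=> [|s] //=; rewrite ltnS -iterS iterSr gy; exact: Ay'.
Qed.

(** A nondecreasing word is determined by the multiplicities of its letters; each is at most [m.-1]
    here, which bounds the length by [l * m.-1]. *)
Lemma monotone_words l m : (0 < l)%N -> (0 < m)%N ->
  exists w : {ffun 'I_l -> 'I_m} -> seq nat, injective w /\
    forall a, [/\ sorted leq (w a), all (fun i => 1 <= i <= l)%N (w a) &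
                  (size (w a) < l * m)%N].
Proof.
move=> l0 m0.
(* Letter [i.+1] is repeated [a i] times. Sorting preserves the counts, from which [a] is
   recovered. *)
pose w (a : {ffun 'I_l -> 'I_m}) :=
  sort leq (flatten [seq nseq (a i) i.+1 | i <- enum 'I_l]).
exists w; split.
  have cw a (i : 'I_l) : count_mem i.+1 (w a) = a i.
    rewrite count_sort count_flatten -map_comp sumnE big_map big_enum/=.
    rewrite (bigD1 i)//= count_nseq /= eqxx mul1n big1 ?addn0// => j ji.
    by rewrite count_nseq/= eqSS (inj_eq val_inj) (negbTE ji).
  by move=> a b ab; apply/ffunP => i; apply: val_inj; rewrite /= -!cw ab.
move=> a; split; first exact: (sort_sorted leq_total).
  rewrite all_sort; apply/allP => j /flattenP[_ /mapP[i _ ->]].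
  by rewrite mem_nseq => /andP[_ /eqP ->]; exact: ltn_ord.
rewrite size_sort size_flatten /shape -map_comp sumnE big_map big_enum/=.
under eq_bigr do rewrite size_nseq.
apply: (@leq_ltn_trans (\sum_(i < l) m.-1)).
  by apply: leq_sum => i _; rewrite -ltnS prednK.
by rewrite sum_nat_const card_ord ltn_pmul2l// prednK.
Qed.

Lemma horseshoe_sep (R : realType) (X : metricType R) (f : X -> X) (k l : nat) :
  (0 < k)%N -> (0 < l)%N -> has_one_way_horseshoe (iter k f) l ->
  \forall e \near (0 : R)^'+, forall m, (0 < m)%N ->
     ((m ^ l)%:R%:E <= sep (k * l * m) e f)%E.
Proof.
move=> k0 l0 [A hA]; have [cA tA [x Alx nrx] _] := hA.
set g := iter k f in hA nrx.
have sepA : \forall e \near (0 : R)^'+, forall i j : 'I_l, i != j ->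
    forall x y, A i.+1 x -> A j.+1 y -> e < mdist x y.
  apply: filter_forall => i; apply: filter_forall => j.
  have [->|ij] := eqVneq i j; first exact: nearW.
  suff : \forall e \near (0 : R)^'+, forall x y, A i.+1 x -> A j.+1 y ->
    e < mdist x y by apply: filterS => e He _.
  apply: near_mdist_gt; first by apply: cA; exact: ltn_ord.
    apply: compact_closed; first exact: metric_hausdorff.
    by apply: cA; exact: ltn_ord.
  by have /trivIsetP := tA; apply => //=.
(* [e] is fixed before [m]: it depends only on the gaps between the sets and on the orbit of [x]. *)
near=> e => m m0.
have e0 : 0 < e by near: e; exact: nbhs_right_gt.
have [w [w_inj wP]] := monotone_words _ _ l0 m0.
have pt a : exists y, iter (size (w a)) g y = x /\
    forall s, (s <= size (w a))%N -> A (nth l (w a) s) (iter s g y).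
  have [ws wl _] := wP a.
  by have [y] := itinerary_point _ _ _ _ _ _ _ hA Alx ws wl; exists y.
have [z zP] := choice pt.
have nth_range a s : (1 <= nth l (w a) s <= l)%N.
  have [_ /allP wl _] := wP a; have [sw|ws] := ltnP s (size (w a)).
    by apply: wl; exact: mem_nth.
  by rewrite nth_default// l0 leqnn.
have <- : #|{ffun 'I_l -> 'I_m}| = (m ^ l)%N by rewrite card_ffun !card_ord.
apply: (@le_sep_card _ _ _ _ _ _ z); first exact: ltW.
(* One step of [g] is [k] steps of [f], so times below [l * m] for [g] become times below
   [k * l * m] for [f]. *)
suff sepg a b : a != b -> exists2 s, (s < l * m)%N &
    e < mdist (iter s g (z a)) (iter s g (z b)).
  move=> a b /sepg[s slm es]; exists (s * k)%N; last by rewrite !iterM.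
  by rewrite -mulnA mulnC ltn_pmul2l.
have nr n : (0 < n)%N -> e < mdist (iter n g x) x.
  by move: n; near: e; exact: near_nonrecurrent.
(* When the longer word ends, [z b'] has just reached [x], whereas [z a'] passed through [x] earlier
   and is now at a positive iterate of it. *)
have shorter a' b' : (size (w a') < size (w b'))%N ->
    e < mdist (iter (size (w b')) g (z a')) (iter (size (w b')) g (z b')).
  move=> ab; rewrite (zP b').1 -(subnK (ltnW ab)) iterD (zP a').1.
  by apply: nr; rewrite subn_gt0.
move=> ab; have [ltab|ltba|eqab] := ltngtP (size (w a)) (size (w b)).
- by exists (size (w b)); [have [] := wP b|exact: shorter].
- by exists (size (w a)); [have [] := wP a|rewrite metric_sym; exact: shorter].
have [s sa ns] : exists2 s, (s < size (w a))%N & nth l (w a) s != nth l (w b) s.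
  apply: contrapT => H; move/eqP: ab; apply; apply: w_inj.
  apply: (eq_from_nth (x0 := l)) => // s sa; apply/eqP/negPn/negP => ns.
  by apply: H; exists s.
exists s; first by have [_ _ /(ltn_trans sa)] := wP a.
have Aa := (zP a).2 s (ltnW sa).
have Ab : A (nth l (w b) s) (iter s g (z b)).
  by apply: (zP b).2; rewrite -eqab ltnW.
have := nth_range a s; have := nth_range b s; move: ns Aa Ab.
(* Letters are at least 1, so both are successors, matching the indexing by ['I_l] in the gap
   estimate. *)
case: (nth l (w a) s) => // i; case: (nth l (w b) s) => // j ij Ai Aj jl il.
have H : forall i j : 'I_l, i != j ->
    forall x y, A i.+1 x -> A j.+1 y -> e < mdist x y by near: e.
by apply: (H (Ordinal il) (Ordinal jl)).
Unshelve. all: by end_near. Qed.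

Theorem theorem8 (R : realType) (X : metricType R) (f : X -> X) (l : nat)
    (cptX : compact [set: X]) (cf : continuous f) (hl : (1 <= l)%N)
    (hf : has_one_way_horseshoe f l \/
          exists2 n : nat, (1 <= n)%N & has_one_way_horseshoe (iter n f) l) :
  (l%:R%:E <= hpol f)%E.
Proof.
have [k k0 hk] : exists2 n : nat, (1 <= n)%N &
    has_one_way_horseshoe (iter n f) l by case: hf => // hf; exists 1%N.
apply: (@hpol_ge_growth _ _ _ _ (k * l)); first by rewrite muln_gt0 k0.
exact: horseshoe_sep.
Qed.
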